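(* A magma with inverses satisfying the C-identity $x\cdot (y\cdot (y\cdot z)) = ((x\cdot y)\cdot y)\cdot z$ (for all $x,y,z$) is a C-loop. Thus, C-loops are defined equationally by $$x\cdot 1 = 1\cdot x = x,\quad x\cdot x^{-1} = x^{-1}\cdot x = 1,\quad x\cdot (y\cdot (y\cdot z)) = ((x\cdot y)\cdot y)\cdot z,$$ that is, a set $M$ with a binary operation $\cdot$ and an element $1\in M$ is a C-loop with neutral element $1$ if and only if there is a unary operation $x\mapsto x^{-1}$ on $M$ such that these identities hold for all $x,y,z\in M$.
   Context: A magma here is a set with a single binary operation $\cdot$ possessing a two-sided neutral element $1$. A magma $M$ is with inverses if for every $x\in M$ there is $y\in M$ satisfying $x\cdot y = y\cdot x = 1$ (such $y$ is not assumed unique). A loop is a magma in which every equation $x\cdot y = z$ has a unique solution whenever two of the elements $x,y,z$ are specified; equivalently, all left translations $y\mapsto x\cdot y$ and all right translations $y\mapsto y\cdot x$ are bijections. A C-loop is a loop satisfying the C-identity $x\cdot (y\cdot (y\cdot z)) = ((x\cdot y)\cdot y)\cdot z$ for all $x,y,z$. *)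

(* Defs.v *)
From mathcomp Require Import all_boot.

Set Implicit Arguments.
Unset Strict Implicit.
Unset Printing Implicit Defensive.

Local Open Scope group_scope.

(* [baseUMagmaType] provides a bare carrier with a binary operation and a
   distinguished element 1, without any axiom. The library's [umagmaType] is not
   used because it additionally demands a [choiceType]. *)

Definition unital_magma (M : baseUMagmaType) : Prop :=
  forall x : M, x * 1 = x /\ 1 * x = x.

Definition magma_with_inverses (M : baseUMagmaType) : Prop :=
  unital_magma M /\ forall x : M, exists y : M, x * y = 1 /\ y * x = 1.

(* The third case, x and y specified and z unknown in x * y = z, holds trivially
   since the operation is a total function. *)
Definition loop (M : baseUMagmaType) : Prop :=
  [/\ unital_magma M,
      forall x z : M, exists! y : M, x * y = z
    & forall y z : M, exists! x : M, x * y = z].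

Definition C_identity (M : baseUMagmaType) : Prop :=
  forall x y z : M, x * (y * (y * z)) = ((x * y) * y) * z.

Definition C_loop (M : baseUMagmaType) : Prop := loop M /\ C_identity M.

(* Main.v *)
Require Import Defs.
From mathcomp Require Import all_boot.
From Stdlib Require IndefiniteDescription.

(** Write [L a] for left translation by [a]. The C-identity says
    [L x (L y)^2 = L ((x * y) * y)]; with a neutral element it gives both
    alternative laws, so that a square can be absorbed into a translation:
    [L a (L b)^2 = L (a * (b * b))]. If [x * y = 1], then [L x (L y)^2 = L y],
    hence
      [L x (L y) = L x (L x (L y)^2) = L (x * x) (L y)^2
                 = L ((x * x) * (y * y)) = L 1 = id].
    The C-identity is its own mirror image, so right translations cancel in the
    same way. A right inverse thus already gives cancellation on both sides, and
    with two-sided inverses every translation is a bijection.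

    Conversely, in a C-loop the cancellation [x * (y * x) = x] and the
    injectivity of [L x] turn a right inverse into a two-sided one, and a choice
    of inverses is the unary operation of the equational definition. *)

Local Open Scope group_scope.

Section CIdentity.

Variable M : baseUMagmaType.
Hypotheses (unitM : unital_magma M) (C_M : C_identity M).

Let mulm1 (x : M) : x * 1 = x. Proof. exact: (unitM x).1. Qed.
Let mul1m (x : M) : 1 * x = x. Proof. exact: (unitM x).2. Qed.

Lemma C_left_alternative (x y : M) : x * (x * y) = (x * x) * y.
Proof. by have := C_M 1 x y; rewrite !mul1m. Qed.

Lemma C_right_alternative (x y : M) : (x * y) * y = x * (y * y).
Proof. by have := C_M x y 1; rewrite !mulm1. Qed.

(** The inverse of a square is the square of the inverse; this is what makes
    the product of translations in the cancellation laws collapse. *)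
Lemma C_mul_squares (x y : M) : x * y = 1 -> x * (x * (y * y)) = 1.
Proof. by move=> xy1; rewrite -(C_right_alternative x y) xy1 mul1m. Qed.

Lemma C_mulKl (x y z : M) : x * y = 1 -> x * (y * z) = z.
Proof.
move=> xy1.
have yzE : y * z = x * (y * (y * z)) by rewrite C_M xy1 mul1m.
rewrite yzE C_left_alternative C_M C_right_alternative -C_left_alternative.
by rewrite C_mul_squares // mul1m.
Qed.

Lemma C_mulKr (x y z : M) : x * y = 1 -> (z * x) * y = z.
Proof.
move=> xy1.
have zxE : z * x = ((z * x) * x) * y by rewrite -C_M xy1 mulm1.
by rewrite zxE C_right_alternative -C_M C_mul_squares // mulm1.
Qed.

End CIdentity.

Lemma magma_with_inverses_C_loop (M : baseUMagmaType) :
  magma_with_inverses M -> C_identity M -> C_loop M.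
Proof.
move=> [unitM invM] C_M; split=> //; split=> // [x z | y z].
- have [y [xy1 yx1]] := invM x; exists (y * z); split; first exact: C_mulKl.
  by move=> t <-; apply: C_mulKl.
- have [x [yx1 xy1]] := invM y; exists (z * x); split; first exact: C_mulKr.
  by move=> t <-; apply: C_mulKr.
Qed.

Lemma C_loop_with_inverses (M : baseUMagmaType) :
  C_loop M -> magma_with_inverses M.
Proof.
move=> [[unitM divl _] C_M]; split=> // x.
have [y [xy1 _]] := divl x 1; exists y; split=> //.
have [t [_ t_uniq]] := divl x x.
have <- : t = y * x by apply: t_uniq; apply: C_mulKl.
by apply: t_uniq; case: (unitM x).
Qed.

Theorem theorem4p3 (M : baseUMagmaType) :
  (magma_with_inverses M -> C_identity M -> C_loop M) /\
  (C_loop M <->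
   exists inv : M -> M, forall x y z : M,
     [/\ x * 1 = x /\ 1 * x = x,
         x * inv x = 1 /\ inv x * x = 1
       & x * (y * (y * z)) = ((x * y) * y) * z]).
Proof.
split; first exact: magma_with_inverses_C_loop.
split=> [loopM | [inv invP]].
  have [unitM invM] := C_loop_with_inverses _ loopM.
  have [inv invP] := IndefiniteDescription.functional_choice _ invM.
  by exists inv => x y z; split; [exact: unitM | exact: invP | exact: loopM.2].
apply: magma_with_inverses_C_loop; last by move=> x y z; case: (invP x y z).
by split=> x; case: (invP x x x) => // _ ? _; exists (inv x).
Qed.
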